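(* Let $(A,\cdot,\Phi=\{\partial_1,\partial_2\})$ be a commutative differential algebra and $(A,[\ ,\ ],\cdot)$ be the induced Poisson algebra of $(A,\cdot,\Phi)$. Let $T\colon V\to A$ be an $\mathcal O$-operator of $(A,\cdot,\Phi)$ associated to a module $(V,\mu,\Omega=\{\alpha_1,\alpha_2\})$. Then $T$ is an $\mathcal O$-operator of the Poisson algebra $(A,[\ ,\ ],\cdot)$ associated to $(V,\rho_\mu,\mu)$, where $(V,\rho_\mu,\mu)$ is the induced module of $(A,[\ ,\ ],\cdot)$ with respect to $(V,\mu,\Omega)$. In particular, when taking $(V,\mu,\Omega)=(A^*,L_A^*,\Psi^*=\{\eth_1^*,\eth_2^*\})$ (for linear maps $\eth_1,\eth_2\colon A\to A$ such that this is a module of $(A,\cdot,\Phi)$), if in addition $\eth_2(\partial_1(a))\cdot b=\eth_1(\partial_2(a))\cdot b$ for all $a,b\in A$, then $T$ is an $\mathcal O$-operator of $(A,[\ ,\ ],\cdot)$ associated to $(A^*,-\mathrm{ad}_A^*,L_A^* )$.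
   Context: All vector spaces and algebras are finite-dimensional over a field $\mathbb F$ of characteristic $0$; ''algebra'' means associative algebra, not necessarily unital. $L_A(a)b=a\cdot b$, $\mathrm{ad}_A(a)b=[a,b]$; for $\mu\colon A\to\mathrm{End}(V)$, $\mu^*(a)=\mu(a)^*$ is the transpose (no sign). Commutative differential algebra $(A,\cdot,\{\partial_1,\partial_2\})$: commutative algebra with commuting derivations. Its induced Poisson algebra is $(A,[\ ,\ ],\cdot)$ with $[a,b]=\partial_1(a)\cdot\partial_2(b)-\partial_2(a)\cdot\partial_1(b)$. A module of it is $(V,\mu,\{\alpha_1,\alpha_2\})$ with $\mu\colon A\to\mathrm{End}(V)$ linear, $\mu(a)\mu(b)=\mu(a\cdot b)$, and commuting linear maps $\alpha_k$ on $V$ with $\alpha_k(\mu(a)v)=\mu(\partial_k(a))v+\mu(a)\alpha_k(v)$. A linear map $T\colon V\to A$ is an $\mathcal O$-operator of $(A,\cdot,\Phi)$ associated to $(V,\mu,\{\alpha_1,\alpha_2\})$ if $T(u)\cdot T(v)=T(\mu(T(u))v+\mu(T(v))u)$ for all $u,v$ and $\partial_kT=T\alpha_k$, $k=1,2$. A module of a Poisson algebra $(A,[\ ,\ ],\cdot)$ is $(V,\rho,\mu)$ with $(V,\rho)$ a module of the Lie algebra, $\mu(a)\mu(b)=\mu(a\cdot b)$, $\rho(a\cdot b)=\mu(b)\rho(a)+\mu(a)\rho(b)$ and $\mu([a,b])=\rho(a)\mu(b)-\mu(b)\rho(a)$. The induced module of the induced Poisson algebra with respect to $(V,\mu,\{\alpha_1,\alpha_2\})$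 is $(V,\rho_\mu,\mu)$ with $\rho_\mu(a)=\mu(\partial_1(a))\alpha_2-\mu(\partial_2(a))\alpha_1$. $T\colon V\to A$ is an $\mathcal O$-operator of $(A,[\ ,\ ],\cdot)$ associated to $(V,\rho,\mu)$ if $[T(u),T(v)]=T(\rho(T(u))v-\rho(T(v))u)$ and $T(u)\cdot T(v)=T(\mu(T(u))v+\mu(T(v))u)$ for all $u,v\in V$. $(A^*,-\mathrm{ad}_A^*,L_A^* )$ is a module of $(A,[\ ,\ ],\cdot)$. *)

(* Defs.v *)
From HB Require Import structures.
From mathcomp Require Import all_boot all_order all_algebra.
From mathcomp Require Import ring.

Set Implicit Arguments.
Unset Strict Implicit.
Unset Printing Implicit Defensive.

Import GRing.Theory VectorInternalTheory.
Local Open Scope ring_scope.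

(* Finite-dimensional spaces are [vectType]s, and the dual of V is
   'Hom(V, F^o). A bilinear map A * V -> V is curried as an element of
   'Hom(A, 'End(V)), so that a multiplication on A coincides with its left
   multiplication map a |-> L_A(a), and a bracket with a |-> ad_A(a). *)

Section Structures.
Variables (F : fieldType) (A V : vectType F).

Record commDiffAlg := CommDiffAlg {
  cda_mul : 'Hom(A, 'End(A));
  cda_d1 : 'End(A);
  cda_d2 : 'End(A);
  cda_mulC : forall a b, cda_mul a b = cda_mul b a;
  cda_mulA : forall a b c,
    cda_mul a (cda_mul b c) = cda_mul (cda_mul a b) c;
  cda_d1M : forall a b,
    cda_d1 (cda_mul a b) = cda_mul (cda_d1 a) b + cda_mul a (cda_d1 b);
  cda_d2M : forall a b,
    cda_d2 (cda_mul a b) = cda_mul (cda_d2 a) b + cda_mul a (cda_d2 b);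
  cda_d12 : forall a, cda_d1 (cda_d2 a) = cda_d2 (cda_d1 a)
}.

Record is_diffModule (D : commDiffAlg) (mu : 'Hom(A, 'End(V)))
    (al1 al2 : 'End(V)) : Prop := IsDiffModule {
  is_dm_mulM : forall a b, (mu a \o mu b)%VF = mu (cda_mul D a b);
  is_dm_al1 : forall a v, al1 (mu a v) = mu (cda_d1 D a) v + mu a (al1 v);
  is_dm_al2 : forall a v, al2 (mu a v) = mu (cda_d2 D a) v + mu a (al2 v);
  is_dm_al12 : (al1 \o al2)%VF = (al2 \o al1)%VF
}.

Record diffModule (D : commDiffAlg) := DiffModule {
  dm_mu : 'Hom(A, 'End(V));
  dm_al1 : 'End(V);
  dm_al2 : 'End(V);
  dmP : is_diffModule D dm_mu dm_al1 dm_al2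
}.

Definition diff_O_operator (D : commDiffAlg) (M : diffModule D)
    (T : 'Hom(V, A)) : Prop :=
  [/\ forall u v,
        cda_mul D (T u) (T v) = T (dm_mu M (T u) v + dm_mu M (T v) u),
      (cda_d1 D \o T)%VF = (T \o dm_al1 M)%VF
    & (cda_d2 D \o T)%VF = (T \o dm_al2 M)%VF].

Record poissonAlg := PoissonAlg {
  pa_br : 'Hom(A, 'End(A));
  pa_mul : 'Hom(A, 'End(A));
  pa_brxx : forall a, pa_br a a = 0;
  pa_jacobi : forall a b c,
    pa_br a (pa_br b c) + pa_br b (pa_br c a) + pa_br c (pa_br a b) = 0;
  pa_mulC : forall a b, pa_mul a b = pa_mul b a;
  pa_mulA : forall a b c, pa_mul a (pa_mul b c) = pa_mul (pa_mul a b) c;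
  pa_leibniz : forall a b c,
    pa_br a (pa_mul b c) = pa_mul (pa_br a b) c + pa_mul b (pa_br a c)
}.

Record poissonModule (P : poissonAlg) := PoissonModule {
  pm_rho : 'Hom(A, 'End(V));
  pm_mu : 'Hom(A, 'End(V));
  pm_lie : forall a b,
    pm_rho (pa_br P a b)
    = (pm_rho a \o pm_rho b)%VF - (pm_rho b \o pm_rho a)%VF;
  pm_mulM : forall a b, (pm_mu a \o pm_mu b)%VF = pm_mu (pa_mul P a b);
  pm_rhoM : forall a b,
    pm_rho (pa_mul P a b)
    = (pm_mu b \o pm_rho a)%VF + (pm_mu a \o pm_rho b)%VF;
  pm_muB : forall a b,
    pm_mu (pa_br P a b) = (pm_rho a \o pm_mu b)%VF - (pm_mu b \o pm_rho a)%VF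
}.

Definition poisson_O_operator (P : poissonAlg) (M : poissonModule P)
    (T : 'Hom(V, A)) : Prop :=
  (forall u v,
     pa_br P (T u) (T v) = T (pm_rho M (T u) v - pm_rho M (T v) u)) /\
  (forall u v,
     pa_mul P (T u) (T v) = T (pm_mu M (T u) v + pm_mu M (T v) u)).

(* rho_mu(a) = mu(d1 a) al2 - mu(d2 a) al1; the induced bracket is the instance
   mu = L_A, al_k = d_k. *)
Definition rho_fun (mu : 'Hom(A, 'End(V))) (d1 d2 : 'End(A))
    (al1 al2 : 'End(V)) (a : A) : 'End(V) :=
  (mu (d1 a) \o al2)%VF - (mu (d2 a) \o al1)%VF.

Fact rho_fun_linear mu d1 d2 al1 al2 : linear (rho_fun mu d1 d2 al1 al2).
Proof.
move=> k a b; apply/lfunP => v.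
rewrite /rho_fun !linearP /= !(add_lfunE, opp_lfunE, scale_lfunE, comp_lfunE).
by rewrite scalerBr opprD addrACA.
Qed.

HB.instance Definition _ mu d1 d2 al1 al2 :=
  GRing.isLinear.Build F A 'End(V) *:%R (rho_fun mu d1 d2 al1 al2)
    (rho_fun_linear mu d1 d2 al1 al2).

Definition rho_of mu d1 d2 al1 al2 : 'Hom(A, 'End(V)) :=
  linfun (rho_fun mu d1 d2 al1 al2).

Lemma rho_ofE mu d1 d2 al1 al2 a v :
  rho_of mu d1 d2 al1 al2 a v = mu (d1 a) (al2 v) - mu (d2 a) (al1 v).
Proof. by rewrite lfunE /= !(add_lfunE, opp_lfunE, comp_lfunE). Qed.

Lemma linfun_compE (U W : vectType F) (f : {linear V -> W}) (g : 'Hom(U, V)) u :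
  (linfun f \o g)%VF u = f (g u).
Proof. by rewrite comp_lfunE lfunE. Qed.

End Structures.

Section Dual.
Variable F : fieldType.

Definition dual (V : vectType F) : vectType F := 'Hom(V, F^o).

(* The identity: a Vector.sort (dual V) is not itself coerced to a function. *)
Definition dual_val (V : vectType F) (phi : dual V) : 'Hom(V, F^o) := phi.

Variables A V : vectType F.

Lemma dualP (phi psi : dual V) :
  (forall v, dual_val phi v = dual_val psi v) -> phi = psi.
Proof. by move=> e; apply/lfunP. Qed.

Lemma dual_addE (phi psi : dual V) v :
  dual_val (phi + psi) v = dual_val phi v + dual_val psi v.
Proof. exact: add_lfunE. Qed.

Lemma dual_oppE (phi : dual V) v : dual_val (- phi) v = - dual_val phi v.
Proof. exact: opp_lfunE. Qed.

Lemma dual_scaleE k (phi : dual V) v :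
  dual_val (k *: phi) v = k * dual_val phi v.
Proof. exact: scale_lfunE. Qed.

Definition tr_fun (f : 'End(V)) (phi : dual V) : dual V :=
  (dual_val phi \o f)%VF.

Lemma tr_funE f phi v : dual_val (tr_fun f phi) v = dual_val phi (f v).
Proof. exact: comp_lfunE. Qed.

Fact tr_fun_linear f : linear (tr_fun f).
Proof.
move=> k x y; apply: dualP => v.
by rewrite tr_funE !dual_addE !dual_scaleE !tr_funE.
Qed.

HB.instance Definition _ f :=
  GRing.isLinear.Build F (dual V) (dual V) *:%R (tr_fun f) (tr_fun_linear f).

Definition transpose (f : 'End(V)) : 'End(dual V) := linfun (tr_fun f).

Lemma transposeE f phi v :
  dual_val (transpose f phi) v = dual_val phi (f v).
Proof. by rewrite lfunE tr_funE. Qed.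

Fact transpose_linear : linear transpose.
Proof.
move=> k f g; apply/lfunP => phi; apply: dualP => v.
rewrite add_lfunE scale_lfunE dual_addE dual_scaleE !transposeE.
by rewrite add_lfunE scale_lfunE linearP.
Qed.

HB.instance Definition _ :=
  GRing.isLinear.Build F 'End(V) 'End(dual V) *:%R transpose transpose_linear.

Definition dual_map (mu : 'Hom(A, 'End(V))) : 'Hom(A, 'End(dual V)) :=
  (linfun transpose \o mu)%VF.

Lemma dual_mapE mu a : dual_map mu a = transpose (mu a).
Proof. exact: linfun_compE. Qed.

End Dual.

Section LieIdentity.
Variables (F : fieldType) (A V : vectType F).
Variables (m : A -> A -> A) (d1 d2 : A -> A).
Variables (mu : A -> V -> V) (al1 al2 : V -> V).
Hypothesis d1M : forall a b, d1 (m a b) = m (d1 a) b + m a (d1 b).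
Hypothesis d2M : forall a b, d2 (m a b) = m (d2 a) b + m a (d2 b).
Hypothesis d1D : {morph d1 : a b / a + b}.
Hypothesis d1N : {morph d1 : a / - a}.
Hypothesis d2D : {morph d2 : a b / a + b}.
Hypothesis d2N : {morph d2 : a / - a}.
Hypothesis d12 : forall a, d1 (d2 a) = d2 (d1 a).
Hypothesis muM : forall a b v, mu (m a b) v = mu a (mu b v).
Hypothesis muC : forall a b v, mu a (mu b v) = mu b (mu a v).
Hypothesis mulD : forall a b v, mu (a + b) v = mu a v + mu b v.
Hypothesis mulN : forall a v, mu (- a) v = - mu a v.
Hypothesis murD : forall a v w, mu a (v + w) = mu a v + mu a w.
Hypothesis murN : forall a v, mu a (- v) = - mu a v.
Hypothesis al1M : forall a v, al1 (mu a v) = mu (d1 a) v + mu a (al1 v).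
Hypothesis al2M : forall a v, al2 (mu a v) = mu (d2 a) v + mu a (al2 v).
Hypothesis al1D : {morph al1 : v w / v + w}.
Hypothesis al1N : {morph al1 : v / - v}.
Hypothesis al2D : {morph al2 : v w / v + w}.
Hypothesis al2N : {morph al2 : v / - v}.
Hypothesis al12 : forall v, al1 (al2 v) = al2 (al1 v).

Let cancelF (x1 x2 x3 x4 x5 x6 x7 x8 y1 y2 y3 y4 : F) :
  x1 + x2 - (x3 + x4) - (x5 + x6 - (x7 + x8))
  = x2 + y1 - (x6 + y2) - (x4 + y3 - (x8 + y4))
    - (x3 + y1 - (x7 + y3) - (x1 + y2 - (x5 + y4))).
Proof. ring. Qed.

Let cancel (x1 x2 x3 x4 x5 x6 x7 x8 y1 y2 y3 y4 : V) :
  x1 + x2 - (x3 + x4) - (x5 + x6 - (x7 + x8))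
  = x2 + y1 - (x6 + y2) - (x4 + y3 - (x8 + y4))
    - (x3 + y1 - (x7 + y3) - (x1 + y2 - (x5 + y4))).
Proof.
apply: (can_inj (@v2rK _ _)); apply/rowP => i.
have vD x y : v2r (x + y : V) 0 i = v2r x 0 i + v2r y 0 i.
  by rewrite linearD mxE.
have vN x : v2r (- x : V) 0 i = - v2r x 0 i.
  by rewrite linearN mxE.
rewrite !(vD, vN); exact: cancelF.
Qed.

Lemma lie_identity a b v (br := fun a b => m (d1 a) (d2 b) - m (d2 a) (d1 b))
    (rho := fun a v => mu (d1 a) (al2 v) - mu (d2 a) (al1 v)) :
  rho (br a b) v = rho a (rho b v) - rho b (rho a v).
Proof.
rewrite {}/rho {}/br.
rewrite !(d1D, d2D, d1N, d2N, d1M, d2M, d12) !(mulD, mulN) !muM.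
rewrite !(al1D, al2D, al1N, al2N, al1M, al2M, al12, d12) !(murD, murN, d12).
rewrite !(muC (d1 b) (d1 a), muC (d1 b) (d2 a)).
rewrite !(muC (d2 b) (d1 a), muC (d2 b) (d2 a)).
rewrite (muC (d1 b) (d2 (d1 a))) (muC (d1 b) (d2 (d2 a))).
rewrite (muC (d2 b) (d1 (d1 a))) (muC (d2 b) (d2 (d1 a))).
exact: cancel.
Qed.

End LieIdentity.
Section Induced.
Variables (F : fieldType) (A : vectType F) (D : commDiffAlg A).

Local Notation m := (cda_mul D).
Local Notation d1 := (cda_d1 D).
Local Notation d2 := (cda_d2 D).

Definition induced_bracket : 'Hom(A, 'End(A)) := rho_of m d1 d2 d1 d2.

Lemma induced_bracketE a b :
  induced_bracket a b = m (d1 a) (d2 b) - m (d2 a) (d1 b).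
Proof. exact: rho_ofE. Qed.

Fact induced_brxx a : induced_bracket a a = 0.
Proof. by rewrite induced_bracketE cda_mulC subrr. Qed.

Let mulCA a b c : m a (m b c) = m b (m a c).
Proof. by rewrite !cda_mulA (cda_mulC D a). Qed.

Let mulrN a v : m a (- v) = - m a v. Proof. exact: linearN. Qed.
Let mulrD a v w : m a (v + w) = m a v + m a w. Proof. exact: linearD. Qed.
Let mulNr a v : m (- a) v = - m a v.
Proof. by rewrite linearN opp_lfunE. Qed.
Let mulDr a b v : m (a + b) v = m a v + m b v.
Proof. by rewrite linearD add_lfunE. Qed.

Fact induced_leibniz a b c :
  induced_bracket a (m b c)
  = m (induced_bracket a b) c + m b (induced_bracket a c).
Proof.
rewrite !induced_bracketE cda_d1M cda_d2M.
rewrite mulDr mulNr !mulrD mulrN -!cda_mulA (mulCA b) (mulCA b (d2 a)).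
by rewrite opprD addrACA.
Qed.

Let brC a b : induced_bracket a b = - induced_bracket b a.
Proof.
by rewrite !induced_bracketE opprB (cda_mulC D (d1 a)) (cda_mulC D (d2 a)).
Qed.

Let brN a b : induced_bracket a (- b) = - induced_bracket a b.
Proof. exact: linearN. Qed.

Fact induced_jacobi a b c :
  induced_bracket a (induced_bracket b c)
  + induced_bracket b (induced_bracket c a)
  + induced_bracket c (induced_bracket a b) = 0.
Proof.
have e : induced_bracket (induced_bracket a b) c
  = induced_bracket a (induced_bracket b c)
    - induced_bracket b (induced_bracket a c).
  rewrite !induced_bracketE.
  apply: (@lie_identity F A A (fun a b => m a b) d1 d2 (fun a b => m a b)
            d1 d2);
    try by [exact: linearD | exact: linearN | exact: cda_d1M | exact: cda_d2M
           | exact: cda_d12 | exact: mulCA | exact: mulDr | exact: mulNr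
           | exact: mulrD | exact: mulrN].
  by move=> x y v; rewrite cda_mulA.
by rewrite (brC c (induced_bracket a b)) e (brC c a) brN subrr.
Qed.

Definition induced_poisson : poissonAlg A :=
  PoissonAlg induced_brxx induced_jacobi (@cda_mulC _ _ D) (@cda_mulA _ _ D)
    induced_leibniz.

Variables (V : vectType F) (M : diffModule V D).

Local Notation mu := (dm_mu M).
Local Notation al1 := (dm_al1 M).
Local Notation al2 := (dm_al2 M).

Definition rho_mu : 'Hom(A, 'End(V)) := rho_of mu d1 d2 al1 al2.

Let muM a b v : mu (m a b) v = mu a (mu b v).
Proof. by rewrite -(is_dm_mulM (dmP M)) comp_lfunE. Qed.

Let muC a b v : mu a (mu b v) = mu b (mu a v).
Proof. by rewrite -!muM cda_mulC. Qed.

Let al12 v : al1 (al2 v) = al2 (al1 v).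
Proof. by rewrite -!comp_lfunE (is_dm_al12 (dmP M)). Qed.

Let murN a v : mu a (- v) = - mu a v. Proof. exact: linearN. Qed.
Let murD a v w : mu a (v + w) = mu a v + mu a w. Proof. exact: linearD. Qed.
Let mulN a v : mu (- a) v = - mu a v.
Proof. by rewrite linearN opp_lfunE. Qed.
Let mulD a b v : mu (a + b) v = mu a v + mu b v.
Proof. by rewrite linearD add_lfunE. Qed.

Fact induced_lie a b :
  rho_mu (induced_bracket a b)
  = (rho_mu a \o rho_mu b)%VF - (rho_mu b \o rho_mu a)%VF.
Proof.
apply/lfunP => v; rewrite add_lfunE opp_lfunE !comp_lfunE.
rewrite /rho_mu !rho_ofE.
apply: (@lie_identity F A V (fun a b => m a b) d1 d2 (fun a v => mu a v)
          al1 al2);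
  by [exact: linearD | exact: linearN | exact: cda_d1M | exact: cda_d2M
     | exact: cda_d12 | exact: muM | exact: muC | exact: mulD | exact: mulN
     | exact: murD | exact: murN
     | exact: (is_dm_al1 (dmP M)) | exact: (is_dm_al2 (dmP M)) | exact: al12].
Qed.

Fact induced_rhoM a b :
  rho_mu (m a b) = (mu b \o rho_mu a)%VF + (mu a \o rho_mu b)%VF.
Proof.
apply/lfunP => v; rewrite add_lfunE !comp_lfunE /rho_mu !rho_ofE.
rewrite cda_d1M cda_d2M !mulD !murD !murN !muM (muC b) (muC b (d2 a)).
by rewrite opprD addrACA.
Qed.

Fact induced_muB a b :
  mu (induced_bracket a b) = (rho_mu a \o mu b)%VF - (mu b \o rho_mu a)%VF.
Proof.
apply/lfunP => v; rewrite add_lfunE opp_lfunE !comp_lfunE /rho_mu !rho_ofE.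
rewrite mulD mulN !muM.
rewrite (is_dm_al1 (dmP M)) (is_dm_al2 (dmP M)) !murD murN.
rewrite (muC b) (muC b (d2 a)).
by rewrite opprD addrACA addrK.
Qed.

Definition induced_module : poissonModule V induced_poisson :=
  @PoissonModule _ _ _ induced_poisson rho_mu mu
    induced_lie (is_dm_mulM (dmP M)) induced_rhoM induced_muB.

End Induced.

Section Coadjoint.
Variables (F : fieldType) (A : vectType F) (P : poissonAlg A).

Local Notation br := (pa_br P).
Local Notation m := (pa_mul P).

(* -ad_A^* : phi |-> - phi o ad_A(a). *)
Definition coad : 'Hom(A, 'End(dual A)) := - dual_map br.

Lemma coadE a phi b : dual_val (coad a phi) b = - dual_val phi (br a b).
Proof. by rewrite 2!opp_lfunE dual_oppE dual_mapE transposeE. Qed.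

Lemma dual_mulE a phi b :
  dual_val (dual_map m a phi) b = dual_val phi (m a b).
Proof. by rewrite dual_mapE transposeE. Qed.

Let brC a b : br a b = - br b a.
Proof.
apply/eqP; rewrite -addr_eq0; apply/eqP.
have := pa_brxx P (a + b).
by rewrite linearD /= !linearD /= !add_lfunE !pa_brxx add0r addr0 addrC.
Qed.

Let brN a b : br a (- b) = - br a b. Proof. exact: linearN. Qed.

Let br_br a b c : br (br a b) c = br a (br b c) - br b (br a c).
Proof.
apply/eqP; rewrite (brC (br a b)) eq_sym -subr_eq0 opprK -brN -(brC c a).
by apply/eqP/pa_jacobi.
Qed.

Let cE := (coadE, dual_mulE, dual_addE, dual_oppE, comp_lfunE,
  add_lfunE, opp_lfunE).

Fact coad_lie a b :
  coad (br a b) = (coad a \o coad b)%VF - (coad b \o coad a)%VF.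
Proof.
apply/lfunP => phi; apply: dualP => c; rewrite !cE.
by rewrite br_br linearB opprB !opprK.
Qed.

Fact coad_mulM a b :
  (dual_map m a \o dual_map m b)%VF = dual_map m (m a b).
Proof.
apply/lfunP => phi; apply: dualP => c; rewrite !cE.
by rewrite pa_mulA (pa_mulC P a b).
Qed.

Let mulrN a b : m a (- b) = - m a b. Proof. exact: linearN. Qed.

Let brM a b c : br (m a b) c = br a (m b c) + br b (m a c).
Proof.
rewrite brC !pa_leibniz (brC c a) (brC c b) mulrN (pa_mulC _ (- _)) mulrN.
rewrite (brC b a) (pa_mulC _ (- _) c) mulrN (pa_mulC _ c).
by rewrite opprD !opprK addrACA subrr add0r.
Qed.

Fact coad_rhoM a b :
  coad (m a b)
  = (dual_map m b \o coad a)%VF + (dual_map m a \o coad b)%VF.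
Proof.
apply/lfunP => phi; apply: dualP => c; rewrite !cE.
by rewrite brM linearD opprD.
Qed.

Fact coad_muB a b :
  dual_map m (br a b)
  = (coad a \o dual_map m b)%VF - (dual_map m b \o coad a)%VF.
Proof.
apply/lfunP => phi; apply: dualP => c; rewrite !cE.
by rewrite pa_leibniz linearD /= opprK addrC addrK.
Qed.

Definition coadjoint_module : poissonModule (dual A) P :=
  PoissonModule coad_lie coad_mulM coad_rhoM coad_muB.

End Coadjoint.

(* Main.v *)
Require Import Defs.
From mathcomp Require Import all_boot all_order all_algebra.

Set Implicit Arguments.
Unset Strict Implicit.
Unset Printing Implicit Defensive.

Import GRing.Theory.
Local Open Scope ring_scope.

(** The derivations pass through T: since d_k T = T al_k, the bracket
    [T u, T v] is the antisymmetrisation of the product T (al1 u) . T (al2 v).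
    Expanding both products by the multiplicative identity of T gives four
    terms under T, which regroup as rho_mu (T u) v - rho_mu (T v) u. This is
    [diff_O_operator_induced].

    For the dual module, the compatibility of eth_k^* with L_A^* says that
    eth_k (b . c) = b . eth_k c - d_k b . c. Hence
    eth2 (d1 a . b) - eth1 (d2 a . b) equals
    eth2 (d1 a) . b - eth1 (d2 a) . b - [a, b], and the additional hypothesis
    cancels the first two terms: the action rho_mu induced on the dual is
    exactly the coadjoint action ([rho_mu_dual]). The second assertion is then
    the first one, because being an O-operator depends on a Poisson module only
    through its two actions. *)

Lemma diff_O_operator_induced (F : fieldType) (A V : vectType F)
    (D : commDiffAlg A) (M : diffModule V D) (T : 'Hom(V, A)) :
  diff_O_operator M T -> poisson_O_operator (induced_module M) T.
Proof.
move=> [TM d1T d2T]; split=> //= u v.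
have {}d1T w : cda_d1 D (T w) = T (dm_al1 M w) by rewrite -!comp_lfunE d1T.
have {}d2T w : cda_d2 D (T w) = T (dm_al2 M w) by rewrite -!comp_lfunE d2T.
rewrite induced_bracketE /rho_mu !rho_ofE !d1T !d2T !TM -linearB.
by congr (T _); rewrite opprB opprD addrACA.
Qed.

(** The pointwise form of the module axiom for eth^* and L_A^*, arranged so that
    eth falls on the left factor of the product. *)
Lemma transpose_derivation (F : fieldType) (A : vectType F)
    (D : commDiffAlg A) (d eth : 'End(A)) (phi : dual A) :
  (forall a psi, transpose eth (dual_map (cda_mul D) a psi)
     = dual_map (cda_mul D) (d a) psi
       + dual_map (cda_mul D) a (transpose eth psi)) ->
  forall a b, dual_val phi (eth (cda_mul D a b))
    = dual_val phi (cda_mul D (eth a) b) - dual_val phi (cda_mul D a (d b)).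
Proof.
move=> ethM a b; have /(congr1 (fun psi => dual_val psi a)) := ethM b phi.
rewrite dual_addE !dual_mapE !transposeE => e.
rewrite (cda_mulC D (eth a)) e (cda_mulC D (d b)) (cda_mulC D b).
by rewrite addrC addKr.
Qed.

Lemma rho_mu_dual (F : fieldType) (A : vectType F) (D : commDiffAlg A)
    (eth1 eth2 : 'End(A))
    (dualM : is_diffModule D (dual_map (cda_mul D))
               (transpose eth1) (transpose eth2)) :
  (forall a b, cda_mul D (eth2 (cda_d1 D a)) b
               = cda_mul D (eth1 (cda_d2 D a)) b) ->
  rho_mu (DiffModule dualM) = coad (induced_poisson D).
Proof.
move=> eth12; apply/lfunP => a; apply/lfunP => phi; apply: dualP => b.
rewrite coadE /rho_mu rho_ofE /= dual_addE dual_oppE !dual_mapE !transposeE.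
rewrite (transpose_derivation phi (is_dm_al1 dualM)).
rewrite (transpose_derivation phi (is_dm_al2 dualM)).
rewrite eth12 induced_bracketE (linearB (dual_val phi)) !opprB.
by rewrite addrC addrA subrK.
Qed.

Theorem proposition5p37 (F : fieldType) (charF0 : [pchar F] =i pred0)
    (A : vectType F) (D : commDiffAlg A) :
  (forall (V : vectType F) (M : diffModule V D) (T : 'Hom(V, A)),
     diff_O_operator M T -> poisson_O_operator (induced_module M) T) /\
  (forall (eth1 eth2 : 'End(A))
     (dualM : is_diffModule D (dual_map (cda_mul D))
                (transpose eth1) (transpose eth2))
     (T : 'Hom(dual A, A)),
     diff_O_operator (DiffModule dualM) T ->
     (forall a b, cda_mul D (eth2 (cda_d1 D a)) b
                  = cda_mul D (eth1 (cda_d2 D a)) b) ->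
     poisson_O_operator (coadjoint_module (induced_poisson D)) T).
Proof.
split=> [V M T|eth1 eth2 dualM T OT eth12]; first exact: diff_O_operator_induced.
have [Tbr Tmul] := diff_O_operator_induced OT; split=> // u v.
by rewrite Tbr /= rho_mu_dual.
Qed.
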